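(* Every Dehn function of a finitely presented group is equivalent to the time function of some (not necessarily deterministic) Turing machine. That is, for every finite presentation $\mathcal P=\langle X\mid R\rangle$ of a group there exists a (possibly non-deterministic, multi-tape) Turing machine $M$ whose time function is equivalent to the Dehn function of $\mathcal P$.
   Context: Dehn function. Let $\mathcal P=\langle X\mid R\rangle$ be a finite presentation of a group $G$. A function $f:\mathbf N\to\mathbf N$ is an isoperimetric function of $\mathcal P$ if for every $n$ and every word $w$ over $X\cup X^{-1}$ with $|w|\le n$ and $w=1$ in $G$ there is a van Kampen diagram over $\mathcal P$ with boundary label $w$ and area (number of cells) at most $f(n)$; equivalently, $w$ is equal in the free group to a product of at most $f(n)$ conjugates of relators from $R$ and their inverses. The Dehn function of $\mathcal P$ is its smallest isoperimetric function. Equivalence. For $f,g:\mathbf N\to\mathbf N$ write $f\preceq g$ if there are non-negative constants $a,b,c,d$ with $f(n)\le a\,g(bn)+cn+d$ for all $n$. The functions $f,g$ are equivalent if $f\preceq g$ and $g\preceq f$. Dehn functions of different finite presentations of the same group are equivalent. Time function. Let $M$ be a deterministic or non-deterministic (multi-tape) Turing machine. Its time function $T(n)$ is defined by: $T(n)$ is the smallest number such that for every input word $w$ accepted by $M$ with $|w|\le n$ there exists a computation of length $\le T(n)$ which accepts $w$. *)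

(* Defs.v *)
From HB Require Import structures.
From mathcomp Require Import all_boot.
From mathcomp Require Import boolp.

Set Implicit Arguments.
Unset Strict Implicit.
Unset Printing Implicit Defensive.

Section Presentations.
Variable X : finType.

(* (x, true) stands for the generator x and (x, false) for its inverse. *)
Definition letter : finType := (X * bool)%type.
Definition word := seq letter.

Definition inv_letter (x : letter) : letter := (x.1, ~~ x.2).
Definition inv_word (w : word) : word := rev (map inv_letter w).

(* Equality of words in the group <X | R>. *)
Inductive group_eq (R : seq word) : word -> word -> Prop :=
| group_eq_refl u : group_eq R u u
| group_eq_sym u v : group_eq R u v -> group_eq R v u
| group_eq_trans u v w : group_eq R u v -> group_eq R v w -> group_eq R u w
| group_eq_cancel u x v : group_eq R (u ++ x :: inv_letter x :: v) (u ++ v)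
| group_eq_relator u r v : r \in R -> group_eq R (u ++ r ++ v) (u ++ v).

(* The free group on X is <X | >. *)
Definition free_eq : word -> word -> Prop := group_eq [::].

(* A pair (g, r) encodes the conjugate g r g^-1. *)
Definition conj_word (c : word * word) : word := c.1 ++ c.2 ++ inv_word c.1.
Definition conj_prod (s : seq (word * word)) : word :=
  flatten (map conj_word s).

Definition area_le (R : seq word) (w : word) (k : nat) : Prop :=
  exists s : seq (word * word),
    [/\ size s <= k,
        all (fun c => c.2 \in R ++ map inv_word R) s &
        free_eq w (conj_prod s)].

Definition isoperimetric (R : seq word) (f : nat -> nat) : Prop :=
  forall n (w : word),
    size w <= n -> group_eq R w [::] -> area_le R w (f n).

Definition dehn_function (R : seq word) (f : nat -> nat) : Prop :=
  isoperimetric R f /\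
  forall g, isoperimetric R g -> forall n, f n <= g n.

End Presentations.

Definition preceq (f g : nat -> nat) : Prop :=
  exists a b c d : nat, forall n, f n <= a * g (b * n) + c * n + d.

Definition equivalent (f g : nat -> nat) : Prop := preceq f g /\ preceq g f.

(* Non-deterministic machines with a read-write input tape and tm_work further
   work tapes; all tapes are infinite in both directions.  A transition gives
   a new state and, for each tape, the symbol to write and the head move
   (None: stay, Some false: left, Some true: right). *)
Record turing_machine := TuringMachine {
  tm_state : finType;
  tm_symbol : finType;
  tm_work : nat;
  tm_blank : tm_symbol;
  tm_input : {set tm_symbol};
  tm_start : tm_state;
  tm_accept : {set tm_state};
  tm_delta : tm_state -> {ffun 'I_tm_work.+1 -> tm_symbol} ->
    {set tm_state * {ffun 'I_tm_work.+1 -> tm_symbol * option bool}};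
  tm_blankP : tm_blank \notin tm_input
}.

Section Computations.
Variable M : turing_machine.

(* (l, a, r): the head scans a, the cells to its right are r, those to its
   left, read away from the head, are l, and all other cells are blank. *)
Definition tape : eqType :=
  (seq (tm_symbol M) * tm_symbol M * seq (tm_symbol M))%type.

Definition config : eqType :=
  (tm_state M * {ffun 'I_(tm_work M).+1 -> tape})%type.

Definition tape_of (w : seq (tm_symbol M)) : tape :=
  ([::], head (tm_blank M) w, behead w).

Definition tape_act (t : tape) (a : tm_symbol M * option bool) : tape :=
  let: (l, _, r) := t in
  match a.2 with
  | None => (l, a.1, r)
  | Some false => (behead l, head (tm_blank M) l, a.1 :: r)
  | Some true => (a.1 :: l, head (tm_blank M) r, behead r)
  end.

Definition scanned (c : config) : {ffun 'I_(tm_work M).+1 -> tm_symbol M} :=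
  [ffun i => (c.2 i).1.2].

Definition step (c c' : config) : bool :=
  [exists a in tm_delta c.1 (scanned c),
     c' == (a.1, [ffun i => tape_act (c.2 i) (a.2 i)])].

Definition init_config (w : seq (tm_symbol M)) : config :=
  (tm_start M, [ffun i => tape_of (if i == ord0 then w else [::])]).

(* The computation is the sequence init_config w :: s, of length size s. *)
Definition accepting_computation (w : seq (tm_symbol M)) (s : seq config) :=
  path step (init_config w) s /\ (last (init_config w) s).1 \in tm_accept M.

Definition input_word (w : seq (tm_symbol M)) : bool :=
  all (fun a => a \in tm_input M) w.

Definition accepted (w : seq (tm_symbol M)) : Prop :=
  exists s, accepting_computation w s.

Definition time_bound (n t : nat) : Prop :=
  forall w, input_word w -> accepted w -> size w <= n ->
    exists2 s, accepting_computation w s & size s <= t.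

Definition time_function (T : nat -> nat) : Prop :=
  forall n, time_bound n (T n) /\ forall t, time_bound n t -> T n <= t.

End Computations.

Lemma least_function (Q : nat -> nat -> Prop) :
  (forall n, exists t, Q n t) ->
  exists f, forall n, Q n (f n) /\ forall t, Q n t -> f n <= t.
Proof.
move=> exQ.
suff /choice[f fP] : forall n, exists m, Q n m /\ forall t, Q n t -> m <= t.
  by exists f.
move=> n.
have exb : exists t, `[< Q n t >] by case: (exQ n) => t Qt; exists t; apply/asboolP.
case: (ex_minnP exb) => m /asboolP Qm min; exists m; split=> // t Qt.
by apply: min; apply/asboolP.
Qed.

Lemma words_bounded (A : finType) (P : seq A -> nat -> Prop) n :
  exists t, forall w, size w <= n -> (exists m, P w m) ->
    exists2 m, P w m & m <= t.
Proof.
have [m mP] : exists m : seq A -> nat,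
    forall w, (exists k, P w k) -> P w (m w).
  suff /choice[m mP] : forall w, exists k, (exists j, P w j) -> P w k by exists m.
  move=> w.
  by have [[k Pk]|no] := pselect (exists k, P w k); [exists k | exists 0].
exists (\max_(i < n.+1) \max_(u : i.-tuple A) m u) => w le_w exP.
exists (m w); first exact: mP.
have lt_w : size w < n.+1 by [].
apply: leq_trans (leq_bigmax (Ordinal lt_w)).
exact: (@leq_bigmax _ (fun u : (size w).-tuple A => m u) (in_tuple w)).
Qed.

Lemma time_function_exists (M : turing_machine) : exists T, @time_function M T.
Proof.
apply: least_function => n.
have [t tP] := words_bounded
  (fun w k => exists2 s, @accepting_computation M w s & size s <= k) n.
exists t => w _ [s acc] le_w.
have [|k [s' acc' le_k] le_t] := tP w le_w; first by exists (size s), s.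
by exists s' => //; apply: leq_trans le_t.
Qed.

Section DehnExists.
Variables (X : finType).
Implicit Types (u v w g : word X) (R : seq (word X)).

Lemma inv_letterK : involutive (@inv_letter X).
Proof. by case=> x b; rewrite /inv_letter /= negbK. Qed.

Lemma inv_wordK : involutive (@inv_word X).
Proof. by move=> w; rewrite /inv_word map_rev revK mapK //; apply: inv_letterK. Qed.

Lemma inv_word_cat u v : inv_word (u ++ v) = inv_word v ++ inv_word u.
Proof. by rewrite /inv_word map_cat rev_cat. Qed.

Lemma group_eq_ctx R a b u v :
  group_eq R u v -> group_eq R (a ++ u ++ b) (a ++ v ++ b).
Proof.
elim=> {u v} [u|u v _ IH|u v w _ IH1 _ IH2|u x v|u r v rR].
- exact: group_eq_refl.
- exact: group_eq_sym.
- exact: group_eq_trans IH2.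
- by rewrite -!catA /= !(catA a); apply: group_eq_cancel.
- by rewrite -!catA !(catA a u); apply: group_eq_relator.
Qed.

Lemma group_eq_mulV R a g b : group_eq R (a ++ g ++ inv_word g ++ b) (a ++ b).
Proof.
elim/last_ind: g => [|g x IH]; first exact: group_eq_refl.
rewrite -cats1 inv_word_cat -!catA; apply: group_eq_trans IH.
by rewrite /= !(catA a g); apply: group_eq_cancel.
Qed.

Lemma group_eq_Vmul R a g b : group_eq R (a ++ inv_word g ++ g ++ b) (a ++ b).
Proof. by have := group_eq_mulV R a (inv_word g) b; rewrite inv_wordK. Qed.

Definition conj_inv (c : word X * word X) := (c.1, inv_word c.2).

Lemma conj_prod_cat (s t : seq (word X * word X)) : conj_prod (s ++ t) = conj_prod s ++ conj_prod t.
Proof. by rewrite /conj_prod map_cat flatten_cat. Qed.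

Lemma inv_conj_prod (s : seq (word X * word X)) :
  inv_word (conj_prod s) = conj_prod (rev (map conj_inv s)).
Proof.
elim: s => // c s IH; rewrite /= rev_cons -cats1 conj_prod_cat -IH.
rewrite /conj_prod /= cats0 inv_word_cat; congr (_ ++ _).
by rewrite /conj_word !inv_word_cat inv_wordK -catA.
Qed.

Lemma group_eq_conj_prod R u v : group_eq R u v ->
  exists2 s, all (fun c => c.2 \in R ++ map (@inv_word X) R) s &
             free_eq u (conj_prod s ++ v).
Proof.
elim=> {u v} [u|u v _ [s sR IH]|u v w _ [s sR IHs] _ [t tR IHt]|u x v|u r v rR].
- by exists [::] => //; apply: group_eq_refl.
- exists (rev (map conj_inv s)).
    rewrite all_rev all_map; apply: sub_all sR => c /=.
    rewrite !mem_cat => /orP[cR|/mapP[r rR ->]]; first by rewrite map_f ?orbT.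
    by rewrite inv_wordK rR.
  rewrite -inv_conj_prod; apply: group_eq_sym.
  have := group_eq_ctx (inv_word (conj_prod s)) [::] IH; rewrite !cats0 => H.
  exact: group_eq_trans H (group_eq_Vmul _ [::] _ _).
- exists (s ++ t); first by rewrite all_cat sR.
  apply: group_eq_trans IHs _; rewrite conj_prod_cat -catA.
  by have := group_eq_ctx (conj_prod s) [::] IHt; rewrite !cats0.
- by exists [::] => //; apply: group_eq_cancel.
- exists [:: (u, r)]; first by rewrite /= mem_cat rR.
  rewrite /conj_prod /= /conj_word /= !cats0 -!catA.
  by apply: group_eq_sym; have := group_eq_Vmul [::] (u ++ r) u v; rewrite -!catA.
Qed.

Lemma dehn_function_exists R : exists f, dehn_function R f.
Proof.
pose Q n t := forall w, size w <= n -> group_eq R w [::] -> area_le R w t.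
have [|f fP] := @least_function Q.
  move=> n; have [t tP] := words_bounded (area_le R) n.
  exists t => w le_w eq_w.
  have [|k [s [le_s sR eq_s]] le_k] := tP w le_w.
    have [s sR] := group_eq_conj_prod eq_w; rewrite cats0 => eq_s.
    by exists (size s), s.
  by exists s; split=> //; apply: leq_trans le_k.
exists f; split=> [n w|g gP n]; first by case: (fP n) => + _; apply.
by case: (fP n) => _; apply=> w; apply: gP.
Qed.

End DehnExists.

(* Main.v *)
Require Import Defs.
From mathcomp Require Import all_boot.
From mathcomp Require Import boolp zify.
From Stdlib Require Import Setoid Morphisms.

Set Implicit Arguments.
Unset Strict Implicit.
Unset Printing Implicit Defensive.

(** Every word [w] that is trivial in the group is recognized by a
non-deterministic machine with two stacks, one on each tape. The stack [V]
holds the rest of the input, the stack [L] the letters already passed, and the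
pair stands for the word [rev L ++ V], with [V = w] and [L] empty at the start.
The machine may put a cyclic conjugate of a relator or of an inverse relator on
top of [V], pass a letter from [V] to [L], or erase the two tops when they are
inverse to each other; it accepts when both stacks are empty.

Soundness is the easy half. One step lowers the area of [rev L ++ V] by at
most one (area_le_move), so an accepting computation of length [t] bounds the
area of the input by [t], and the Dehn function is at most the time function.

For completeness, a word of area [k] and length [n] has to be accepted in
[O(k + n)] steps. In a van Kampen diagram this is a walk along the boundary:
an edge on a cell is pushed across that cell by inserting the rest of the
boundary of the cell before it, an edge on no cell is passed, and is erased
against its twin. Each cell is inserted once and each edge passed at most once,
so that no time is lost in moving to and fro. The algebraic form of this
statement is that at most [k] insertions of cyclic conjugates of relators, at
arbitrary places of [w] and of the letters inserted earlier, turn [w] into a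
word that is trivial in the free group (area_le_fillable). A product of [k]
conjugates clearly has this property: insert the inverse of each relator beside
it. What has to be shown is that the property depends only on the element of
the free group, that is, that it survives the deletion of a pair [x x^-1]
(fillable_cancel). The letters inserted between [x] and [x^-1] then have to go
elsewhere, and the cancellation partner of [x] in the final word shows where.

The insertions can be reordered so that they are made from left to right
(ins_scan), each on top of the unread part; the run of the machine is then the
usual reduction of the resulting word of length [O(k + n)] with a stack
(accepts_scan). *)

(** * Words and free reduction *)

Lemma eq_cat_cases (T : Type) (a b c d : seq T) : a ++ b = c ++ d ->
  (exists e, c = a ++ e /\ b = e ++ d) \/ (exists e, a = c ++ e /\ d = e ++ b).
Proof.
elim: a c => [|x a IH] [|y c] /=.
- by move=> ->; left; exists [::].
- by move=> ->; left; exists (y :: c).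
- by move=> <-; right; exists (x :: a).
case=> -> /IH[[e [-> ->]]|[e [-> ->]]]; [left | right]; by exists e.
Qed.

Lemma eq_cat_cons_cases (T : Type) (a b c d : seq T) x : a ++ b = c ++ x :: d ->
  (exists e, c = a ++ e /\ b = e ++ x :: d) \/
  (exists e, a = c ++ x :: e /\ d = e ++ b).
Proof.
move=> /eq_cat_cases[?|[[|y e] [-> /=]]]; first by left.
- by move=> <-; left; exists [::]; rewrite !cats0.
- by case=> -> ->; right; exists e.
Qed.

Section FreeGroup.
Variable X : finType.
Implicit Types (u v w : word X) (x y : letter X).

#[local] Instance group_eq_equivalence (R : seq (word X)) :
  Equivalence (group_eq R).
Proof.
split; first exact: group_eq_refl.
  by move=> u v; apply: group_eq_sym.
by move=> u v w; apply: group_eq_trans.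
Qed.

#[local] Instance group_eq_cat (R : seq (word X)) :
  Proper (group_eq R ==> group_eq R ==> group_eq R) (@cat (letter X)).
Proof.
move=> u u' eq_u v v' eq_v.
apply: (@group_eq_trans _ _ _ (u' ++ v)).
  exact: (group_eq_ctx [::] v eq_u).
by have := group_eq_ctx u' [::] eq_v; rewrite !cats0.
Qed.

#[local] Instance free_eq_equivalence : Equivalence (@free_eq X).
Proof. exact: group_eq_equivalence. Qed.

Lemma free_eq_refl u : free_eq u u.
Proof. exact: group_eq_refl. Qed.
#[local] Hint Resolve free_eq_refl : core.

#[local] Instance free_eq_cat :
  Proper (@free_eq X ==> @free_eq X ==> @free_eq X) (@cat (letter X)).
Proof. exact: group_eq_cat. Qed.

#[local] Instance free_eq_cons x :
  Proper (@free_eq X ==> @free_eq X) (@cons (letter X) x).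
Proof. by move=> u v /(group_eq_ctx [:: x] [::]); rewrite !cats0. Qed.

Definition reduced u :=
  sorted (fun x y => y != inv_letter x) u.

Definition red_cons x L : word X :=
  if L is y :: L' then if y == inv_letter x then L' else x :: L else [:: x].

Fixpoint red L u : word X := if u is x :: u' then red (red_cons x L) u' else L.

Lemma red_cat L u v : red L (u ++ v) = red (red L u) v.
Proof. by elim: u L => //= x u IH L. Qed.

Lemma reduced_red_cons x L : reduced L -> reduced (red_cons x L).
Proof.
case: L => //= y L yL; case: eqP => [_|/eqP ne_y]; last by rewrite /= ne_y.
exact: path_sorted yL.
Qed.

Lemma reduced_red L u : reduced L -> reduced (red L u).
Proof. by elim: u L => //= x u IH L Lr; apply/IH/reduced_red_cons. Qed.

Lemma red_consK x L : reduced L -> red_cons (inv_letter x) (red_cons x L) = L.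
Proof.
case: L => [|y L] /=; first by rewrite inv_letterK eqxx.
case: eqP => [->|_ _] /=; last by rewrite inv_letterK eqxx.
by case: L => //= z L /andP[/negPf-> _].
Qed.

Lemma red_free_eq u v : free_eq u v -> red [::] u = red [::] v.
Proof.
elim=> {u v} // [u v w _ -> //|u x v].
by rewrite !red_cat /= red_consK //; apply: reduced_red.
Qed.

Lemma free_eq_mulV u x v : free_eq (u ++ x :: inv_letter x :: v) (u ++ v).
Proof. exact: group_eq_cancel. Qed.

Lemma free_eq_Vmul u x v : free_eq (u ++ inv_letter x :: x :: v) (u ++ v).
Proof. by have := free_eq_mulV u (inv_letter x) v; rewrite inv_letterK. Qed.

(** Words reducible to the empty word by erasing pairs, read backwards: an
induction on this predicate sees how the letters are paired. *)
Inductive dyck : word X -> Prop :=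
| dyck_nil : dyck [::]
| dyck_pair u y v : dyck (u ++ v) -> dyck (u ++ y :: inv_letter y :: v).

Lemma red_dyck L u : red L u = [::] -> dyck (rev L ++ u).
Proof.
elim: u L => [|x u IH] L /=; first by move=> ->; apply: dyck_nil.
case: L => [|y L] /= => [/IH //|].
case: eqP => [-> /IH uL|_ /IH]; last first.
  by rewrite [rev (x :: _)]rev_cons cat_rcons.
rewrite rev_cons cat_rcons -[in X in _ :: X](inv_letterK x).
exact: dyck_pair.
Qed.

Lemma dyck_free_eq w : free_eq w [::] -> dyck w.
Proof. by move/red_free_eq; apply: red_dyck [::] w. Qed.

(** In a freely trivial word every letter is erased against a partner, and what
lies between them is erased before them, hence is freely trivial too. *)
Lemma free_eq_partner u x v : free_eq (u ++ x :: v) [::] ->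
  (exists u1 u2, u = u1 ++ inv_letter x :: u2 /\ free_eq u2 [::]) \/
  (exists v1 v2, v = v1 ++ inv_letter x :: v2 /\ free_eq v1 [::]).
Proof.
move=> /dyck_free_eq; move: {-1}(u ++ x :: v) (erefl (u ++ x :: v)) => w + dw.
elim: dw u v => {w} [|a y b _ IH] u v; first by case: u.
move=> E; have [[[|z c] [eq_a /=]]|[c [-> /=]]] := eq_cat_cons_cases E.
- case=> -> ->; right; exists [::], b; split=> //; exact: group_eq_refl.
- case=> zx ->; rewrite -{z}zx in eq_a.
  have [|[u1 [u2 [eq_u u2_1]]]|[v1 [v2 [eq_v v1_1]]]] := IH u (c ++ b).
  + by rewrite eq_a -catA.
  + by left; exists u1, u2.
  + have [[e [eq_v1 ->]]|[e [-> eq_v2]]] := eq_cat_cons_cases eq_v.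
      right; exists (c ++ y :: inv_letter y :: e), v2.
      rewrite -catA; split=> //; apply: group_eq_trans (free_eq_mulV _ _ _) _.
      by rewrite -eq_v1.
    right; exists v1, (e ++ y :: inv_letter y :: b).
    by rewrite -catA.
- case: c => [|t c] /= [].
    move=> <- <-; left; exists a, [::].
    rewrite inv_letterK; split=> //; exact: group_eq_refl.
  move=> <- eq_b.
  have [|[u1 [u2 [eq_u u2_1]]]|[v1 [v2 [eq_v v1_1]]]] := IH (a ++ c) v.
  + by rewrite -catA eq_b.
  + have [[e [_ ->]]|[e [-> eq_u2]]] := eq_cat_cons_cases eq_u.
      left; exists (a ++ y :: inv_letter y :: e), u2.
      by rewrite -catA.
    left; exists u1, (e ++ y :: inv_letter y :: c).
    rewrite -catA; split=> //; apply: group_eq_trans (free_eq_mulV _ _ _) _.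
    by rewrite -eq_u2.
  + by right; exists v1, v2.
Qed.

(** * Filling a word by insertions *)

Section Insertions.
Variable S : seq (word X).

(** The insertions are made one after the other, so that a word may be inserted
inside one that was inserted before; [k] is only an upper bound for their
number, which makes [ins] monotone in it. *)
Inductive ins : nat -> word X -> word X -> Prop :=
| ins_refl k w : ins k w w
| ins_one k w u s v : s \in S -> ins k w (u ++ v) -> ins k.+1 w (u ++ s ++ v).

Lemma ins_le j k w W : j <= k -> ins j w W -> ins k w W.
Proof.
move=> + h; elim: h k => {j w W} [j w|j w u s v sS _ IH] [|k] //.
- by move=> _; apply: ins_refl.
- by move=> _; apply: ins_refl.
- by move=> le_jk; apply: ins_one (IH _ le_jk).
Qed.

Lemma ins_trans j k u v w : ins j u v -> ins k v w -> ins (j + k) u w.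
Proof.
move=> uv h; elim: h uv => {k v w} [k v|k v a s b sS _ IH] uv.
  exact: ins_le (leq_addr _ _) uv.
by rewrite addnS; apply: ins_one (IH uv).
Qed.

Lemma ins_ctx k a w W b : ins k w W -> ins k (a ++ w ++ b) (a ++ W ++ b).
Proof.
elim=> {k w W} [k w|k w u s v sS _]; first exact: ins_refl.
by rewrite -!catA !(catA a); apply: ins_one.
Qed.

Lemma ins_cat j k u U v V :
  ins j u U -> ins k v V -> ins (j + k) (u ++ v) (U ++ V).
Proof.
move=> uU vV; apply: ins_trans (ins_ctx [::] v uU) _.
by have := ins_ctx U [::] vV; rewrite !cats0.
Qed.

Lemma ins_mid j k w u Y v :
  ins j w (u ++ v) -> ins k [::] Y -> ins (j + k) w (u ++ Y ++ v).
Proof. by move=> wuv /(ins_ctx u v); apply: ins_trans. Qed.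

(** A letter of the initial word survives all insertions, and each insertion
takes place on one side of it. *)
Lemma ins_cons_inv k u x v W : ins k (u ++ x :: v) W ->
  exists i j U V, [/\ i + j <= k, W = U ++ x :: V, ins i u U & ins j v V].
Proof.
move: {-1}(u ++ x :: v) (erefl (u ++ x :: v)) => w + h.
elim: h u v => {k w W} [k w u v <-|k w a s b sS _ IH u v /IH {IH}].
  by exists 0, 0, u, v; split=> //; apply: ins_refl.
case=> i [j [U [V [le_k eq_ab uU vV]]]].
have [[e [eq_U ->]]|[e [-> eq_V]]] := eq_cat_cons_cases eq_ab.
  exists i.+1, j, (a ++ s ++ e), V; split; rewrite -?catA //.
  by apply: ins_one; rewrite -?eq_U.
exists i, j.+1, U, (e ++ s ++ b); split; rewrite -?catA ?addnS //.
by apply: ins_one; rewrite -?eq_V.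
Qed.

(** Closure under rotation makes insertions independent of the point at which
the boundary of a cell is cut open. *)
Hypothesis rotS : forall a b, a ++ b \in S -> b ++ a \in S.

(** A word built from nothing can be read from any starting point. The case that
needs an idea is a cut inside the last inserted word: then that word, rotated,
is inserted first, and the others in the middle of it. *)
Lemma ins_rot k u v : ins k [::] (u ++ v) -> ins k [::] (v ++ u).
Proof.
move: {1 3}[::] (erefl (Nil (letter X))) => w w0.
move: {-1}(u ++ v) (erefl (u ++ v)) => W + h.
elim: h u v w0 => {k w W} [k w|k w a s b sS h IH] u v w0.
  rewrite w0 => /(congr1 size)/eqP; rewrite size_cat addn_eq0 !size_eq0.
  by move=> /andP[/eqP-> /eqP->]; apply: ins_refl.
move=> /eq_cat_cases[[e [eq_a ->]]|[e [-> ]]]; last first.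
  move=> /eq_cat_cases[[f [-> eq_b]]|[f [eq_s ->]]].
    rewrite catA; apply: ins_one => //; rewrite -catA.
    by apply: IH; rewrite // eq_b -catA.
  have Z : ins k [::] (b ++ a) by apply: IH.
  have : ins 1 [::] (f ++ e).
    rewrite -[f ++ e]cats0; apply: (@ins_one 0 _ [::] (f ++ e) [::]).
      by apply: rotS; rewrite -eq_s.
    exact: ins_refl.
  by move=> /ins_mid/(_ Z); rewrite add1n -!catA.
rewrite -!catA; apply: ins_one => //; rewrite catA.
by apply: IH; rewrite // eq_a catA.
Qed.

(** The analogue of bounding a disc diagram with at most [k] cells. *)
Definition fillable k w := exists2 W, ins k w W & free_eq W [::].

Lemma free_eq_cat_rot u v : free_eq (u ++ v) [::] -> free_eq (v ++ u) [::].
Proof.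
move=> uv1.
have v1 : free_eq (v ++ inv_word v) [::].
  by have := group_eq_mulV [::] [::] v [::]; rewrite /= cats0.
transitivity (v ++ (u ++ v) ++ inv_word v); last by rewrite uv1.
by rewrite -!catA v1 cats0.
Qed.

(** Without the pair [x x^-1] the word [Y] inserted between its two halves has no
place of its own. If the partner of [x] lies outside of [Y], then [Y] is
inserted just before this partner, where it meets the same letter [x^-1] as
before; if the partner splits [Y] as [B1 x^-1 e], with [B1] trivial, then [Y] is
rotated to [e B1 x^-1], which replaces the whole of [x Y x^-1]. *)
Lemma fillable_cancel k u x v :
  fillable k (u ++ x :: inv_letter x :: v) -> fillable k (u ++ v).
Proof.
case=> W0 /ins_cons_inv[i [j [U [W [le_k -> uU]]]]].
move=> /(@ins_cons_inv _ [::])[j1 [j2 [Y [V [le_j -> Y1 vV]]]]] W1.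
have le_k3 : i + j2 + j1 <= k.
  by apply: leq_trans le_k; rewrite -addnA leq_add2l addnC.
have insY P Q Z : U ++ V = P ++ Q -> ins j1 [::] Z ->
    ins k (u ++ v) (P ++ Z ++ Q).
  move=> eqPQ Z1; apply/(ins_le le_k3)/ins_mid => //.
  by rewrite -eqPQ; apply: ins_cat.
have [[U1 [U2 [eq_U U2_1]]]|[B1 [B2 [eq_B B1_1]]]] := free_eq_partner W1.
- exists (U1 ++ Y ++ inv_letter x :: U2 ++ V).
    by apply: insY; rewrite // eq_U -catA.
  (* Both this word and W reduce to U1 Y x^-1 V. *)
  rewrite U2_1 /=; move: W1; rewrite eq_U U2_1 -!catA /=.
  by rewrite free_eq_Vmul.
have [[e [eq_B1 eq_V]]|[e [eq_Y eq_B2]]] := eq_cat_cons_cases eq_B.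
- case: e => [|z e] in eq_B1 eq_V *.
    (* The partner of x is the deleted x^-1, hence Y is trivial. *)
    rewrite cats0 in eq_B1; exists (U ++ Y ++ V); first exact: insY.
    by move: W1; rewrite -eq_B1 B1_1 /= free_eq_mulV.
  move: eq_V eq_B1 => [<-{z} eq_V] eq_B1.
  exists ((U ++ e) ++ Y ++ inv_letter x :: B2).
    by apply: insY; rewrite // -catA eq_V.
  (* Y x^-1 e is trivial, and so is its conjugate e Y x^-1. *)
  have eY : free_eq (e ++ Y ++ [:: inv_letter x]) [::].
    by apply: free_eq_cat_rot; rewrite -catA -eq_B1.
  move: W1 eY; rewrite eq_B B1_1 /= free_eq_mulV => W1 eY.
  have -> : (U ++ e) ++ Y ++ inv_letter x :: B2 =
      U ++ (e ++ Y ++ [:: inv_letter x]) ++ B2 by rewrite -!catA.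
  by rewrite eY.
- exists (U ++ (e ++ B1 ++ [:: inv_letter x]) ++ V).
    apply: insY => //; apply: ins_rot.
    by rewrite -catA -eq_Y.
  move: W1; rewrite eq_Y B1_1 /= free_eq_mulV -!catA.
  exact.
Qed.

(** The place between [u] and [v] can be followed through the insertions, and
they can be made as well when [p] stands there. *)
Lemma ins_cat_gap k w W u v p : ins k w W -> w = u ++ v ->
  exists U V, W = U ++ V /\ ins k (u ++ p ++ v) (U ++ p ++ V).
Proof.
move=> h; elim: h => {k w W} [k w|k w a s b sS _ IH] eq_w.
  by exists u, v; split=> //; apply: ins_refl.
have [U [V [eq_ab h]]] := IH eq_w.
have [[e [eq_U ->]]|[e [-> eq_V]]] := eq_cat_cases eq_ab;
  rewrite ?eq_U ?eq_V in h.
  exists (a ++ s ++ e), V; split; first by rewrite -!catA.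
  by rewrite -!catA in h *; apply: ins_one h.
exists U, (e ++ s ++ b); split; first by rewrite -!catA.
by rewrite !catA -(catA _ s) in h *; apply: ins_one h.
Qed.

Lemma fillable_free_eq k u v : free_eq u v -> fillable k u <-> fillable k v.
Proof.
elim=> {u v} // [u v _ ->//|u v w _ IH1 _ IH2|u x v].
  by rewrite IH1.
split; first exact: fillable_cancel.
case=> W /(@ins_cat_gap _ _ _ u v [:: x; inv_letter x])/(_ erefl)[U [V [-> h]]].
move=> UV1; exists (U ++ [:: x; inv_letter x] ++ V) => //.
by apply: group_eq_trans UV1; apply: free_eq_mulV.
Qed.

Lemma size_ins k w W : ins k w W -> size W <= size w + k * \max_(s <- S) size s.
Proof.
elim=> {k w W} [k w|k w u s v sS _]; first exact: leq_addr.
rewrite !size_cat addnCA mulSn (addnCA (size w)) => le_w; apply: leq_add => //.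
exact: leq_bigmax_seq.
Qed.

(** Insertions made from left to right: the word is read letter by letter, and a
word is only ever inserted at the reading position. *)
Inductive scan : nat -> word X -> word X -> Prop :=
| scan_nil k : scan k [::] [::]
| scan_cons k x v W : scan k v W -> scan k (x :: v) (x :: W)
| scan_ins k s v W : s \in S -> scan k (s ++ v) W -> scan k.+1 v W.

Lemma scan_catl k u v W : scan k v W -> scan k (u ++ v) (u ++ W).
Proof. by move=> h; elim: u => //= x u IH; apply: scan_cons. Qed.

Lemma scan_refl k w : scan k w w.
Proof. by rewrite -[w]cats0; apply/scan_catl/scan_nil. Qed.

Lemma scan_one k w W u s v : s \in S -> scan k w W -> W = u ++ v ->
  scan k.+1 w (u ++ s ++ v).
Proof.
move=> sS h; elim: h u => {k w W} [k|k x w W h IH|k t w W tS _ IH] u eq_W.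
- case: u v eq_W => // -[] // _; apply: (scan_ins sS); exact: scan_refl.
- case: u eq_W => [|y u] /=; last by case=> -> /IH/scan_cons.
  by move=> <-; apply: (scan_ins sS); apply/scan_catl/scan_cons.
- by apply: (scan_ins tS); apply: IH.
Qed.

Lemma ins_scan k w W : ins k w W -> scan k w W.
Proof.
elim=> {k w W} [k w|k w u s v sS _ IH]; first exact: scan_refl.
exact: scan_one sS IH erefl.
Qed.

End Insertions.

(** * Area and cyclic conjugates of relators *)

Section Area.
Variable R : seq (word X).

Definition relators := R ++ map (@inv_word X) R.

(** The empty word is left out: a machine that makes room for a word before it
writes it cannot insert nothing, and an empty relator fills no area. *)
Definition cyclic_relators : seq (word X) :=
  [seq rot i r | r <- relators, i <- iota 0 (size r)].

Lemma cyclic_relatorsP s :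
  reflect (exists u v, [/\ s != [::], s = v ++ u & u ++ v \in relators])
          (s \in cyclic_relators).
Proof.
apply: (iffP allpairsPdep) => [[r [i [rR + ->]]]|[u [v [s0 eq_s rR]]]].
  rewrite mem_iota add0n /= => lt_i; exists (take i r), (drop i r).
  by rewrite cat_take_drop -size_eq0 size_rot -lt0n (leq_ltn_trans _ lt_i).
exists (u ++ v), (if v is [::] then 0 else size u).
rewrite mem_iota add0n /=; case: v => [|x v] in eq_s rR *.
  rewrite cats0 in rR *; rewrite rot0 eq_s /=; split=> //.
  by move: s0; rewrite eq_s -size_eq0 -lt0n.
by rewrite rot_size_cat size_cat /= addnS leq_addr.
Qed.

Lemma rot_cyclic_relators a b :
  a ++ b \in cyclic_relators -> b ++ a \in cyclic_relators.
Proof.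
case/cyclic_relatorsP=> u [v [ab0 eq_ab uvR]]; apply/cyclic_relatorsP.
have ba0 : b ++ a != [::].
  by move: ab0; rewrite -!size_eq0 !size_cat addnC.
have [[e [eq_v eq_b]]|[e [eq_a eq_u]]] := eq_cat_cases eq_ab.
  exists (u ++ a), e; split; rewrite // ?eq_b -?catA //.
  by rewrite -eq_v.
exists e, (b ++ v); split; rewrite // ?eq_a ?catA //.
by rewrite -eq_u.
Qed.

Lemma inv_relators r : r \in relators -> inv_word r \in relators.
Proof.
rewrite !mem_cat => /orP[rR|/mapP[s sR ->]]; first by rewrite map_f ?orbT.
by rewrite inv_wordK sR.
Qed.

Lemma inv_cyclic_relators r :
  r != [::] -> r \in relators -> inv_word r \in cyclic_relators.
Proof.
move=> r0 rR; apply/cyclic_relatorsP; exists [::], (inv_word r).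
rewrite cats0 inv_relators //; split=> //.
by move: r0; rewrite -!size_eq0 size_rev size_map.
Qed.

(** Inserting [r^-1] before [r] in [g r g^-1] leaves a freely trivial word, with
one insertion for each conjugate. *)
Lemma area_le_fillable w k :
  area_le R w k -> exists2 j, j <= k & fillable cyclic_relators j w.
Proof.
case=> t [le_t tR /(fillable_free_eq rot_cyclic_relators) eq_w].
exists (size t) => //; apply/eq_w.
elim: t tR {eq_w le_t} => [_|[g r] t IH /= /andP[rR /IH{}IH]].
  by exists [::]; first exact: ins_refl.
rewrite /conj_prod /= -/(conj_prod t) /conj_word /=.
have free_t : free_eq (g ++ inv_word g ++ conj_prod t) (conj_prod t).
  exact: group_eq_mulV [::] g (conj_prod t).
rewrite -!catA; have [->|r0] := eqVneq r [::].
  apply/(fillable_free_eq rot_cyclic_relators _ free_t).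
  by case: IH => W h W1; exists W => //; apply: ins_le h.
have free_rt :
    free_eq (g ++ inv_word r ++ r ++ inv_word g ++ conj_prod t) (conj_prod t).
  exact: group_eq_trans (group_eq_Vmul _ _ _ _) free_t.
have [_ /(_ IH)[W h W1]] :=
  fillable_free_eq rot_cyclic_relators (size t) free_rt.
exists W => //; apply: (ins_trans (j := 1)) h.
by apply: ins_one (inv_cyclic_relators r0 rR) _; apply: (ins_refl _ 0).
Qed.

Lemma area_le_scan w k : area_le R w k ->
  exists2 W, scan cyclic_relators k w W /\
      size W <= size w + k * \max_(s <- cyclic_relators) size s &
    red [::] W = [::].
Proof.
case/area_le_fillable=> j le_j [W h W1]; exists W; last exact: red_free_eq W1.
by have := ins_le le_j h; split; [apply: ins_scan | apply: size_ins].
Qed.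

Lemma area_le_nil k : area_le R [::] k.
Proof. by exists [::]. Qed.

Lemma area_le_free_eq u v k : free_eq u v -> area_le R v k -> area_le R u k.
Proof.
by move=> uv [s [le_s sR eq_s]]; exists s; split=> //; apply: group_eq_trans uv _.
Qed.

Lemma area_leW j k w : j <= k -> area_le R w j -> area_le R w k.
Proof.
by move=> le_j [s [le_s sR eq_s]]; exists s; split=> //; apply: leq_trans le_j.
Qed.

(** With [s = b a] and [a b] a relator, [u s v = g (a b) g^-1 (u v)] for
[g = u a^-1]. *)
Lemma area_le_delete u s v k : s \in cyclic_relators ->
  area_le R (u ++ s ++ v) k -> area_le R (u ++ v) k.+1.
Proof.
case/cyclic_relatorsP=> a [b [_ -> abR]] [t [le_t tR eq_t]].
pose g := u ++ inv_word a.
exists ((g, inv_word (a ++ b)) :: t); split=> //=; first by rewrite inv_relators.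
rewrite /conj_prod /= -/(conj_prod t) /conj_word /= -eq_t.
rewrite /g !inv_word_cat inv_wordK -!catA.
have Vmul (c d : word X) : free_eq (inv_word c ++ c ++ d) d.
  exact: group_eq_Vmul [::] c d.
by rewrite (Vmul a) (Vmul u) (Vmul b) (Vmul a).
Qed.

Lemma area_le_group_eq w k : area_le R w k -> group_eq R w [::].
Proof.
case=> t [_ tR eq_w].
have freeR u v : free_eq u v -> group_eq R u v.
  elim=> {u v} [u|u v _|u v z _ IH1 _ IH2|u x v|//].
  - exact: group_eq_refl.
  - exact: group_eq_sym.
  - exact: group_eq_trans IH2.
  - exact: group_eq_cancel.
apply: group_eq_trans (freeR _ _ eq_w) _.
elim: t tR {eq_w} => [_|[g r] t IH /= /andP[rR /IH{}IH]].
  exact: group_eq_refl.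
rewrite /conj_prod /= -/(conj_prod t) /conj_word /= IH cats0.
have /(group_eq_ctx g (inv_word g)) : group_eq R r [::].
  move: rR; rewrite mem_cat => /orP[rR|/mapP[s sR ->]].
    by have := group_eq_relator [::] [::] rR; rewrite cats0.
  have := group_eq_relator (inv_word s) [::] sR; rewrite !cats0 => <-.
  by have := group_eq_Vmul R [::] s [::]; rewrite /= cats0.
move=> /group_eq_trans; apply.
by have := group_eq_mulV R [::] g [::]; rewrite /= cats0.
Qed.

End Area.
End FreeGroup.

(** * The two-stack machine *)

Section Machine.
Variables (X : finType) (S : seq (word X)).
Implicit Types (V L u s : word X) (x : letter X).

Notation symbol := (option (letter X)).
(** The maximum with 1 makes room for the single letter passed from [V] to
[L]. *)
Definition buffer_size := maxn 1 (\max_(s <- S) size s).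
Notation buffer := (buffer_size.-bseq (letter X)).
(** The state [Some (b, s)] means that the letters of [s] still have to be
written on the stack [L] if [b] holds, and on the stack [V] otherwise: a word is
pushed in several steps, its last letter first. [None] is the accepting state.
*)
Definition machine_state : finType := option (bool * buffer).

Notation action := (symbol * option bool)%type.
(** Both stacks grow to the left, and the head stands on the top. Growing leaves
the head on a blank cell, the hole that the next letter is to fill. *)
Definition keep (y : symbol) : action := (y, None).
Definition pop : action := (None, Some true).
Definition grow (y : symbol) : action := (y, Some false).
Definition fill x s : action := (Some x, if s is [::] then None else Some false).

Definition idle b : machine_state := Some (b, [bseq]).

(** The first tape carries [V] and the second one [L]. *)
Inductive instr :
  machine_state -> symbol -> symbol -> machine_state -> action -> action -> Prop :=
| instr_insert b (s : buffer) y0 y1 : (s : word X) \in S ->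
    instr (idle b) y0 y1 (Some (false, s)) (grow y0) (keep y1)
| instr_shift b x (s : buffer) y1 : s = [:: x] :> word X ->
    instr (idle b) (Some x) y1 (Some (true, s)) pop (grow y1)
| instr_cancel b x :
    instr (idle b) (Some x) (Some (inv_letter x)) (idle false) pop pop
| instr_fillV x (s s' : buffer) y0 y1 : s = rcons s' x :> word X ->
    instr (Some (false, s)) y0 y1 (Some (false, s')) (fill x s') (keep y1)
| instr_fillL x (s s' : buffer) y0 y1 : s = rcons s' x :> word X ->
    instr (Some (true, s)) y0 y1 (Some (true, s')) (keep y0) (fill x s')
| instr_accept b :
    instr (idle b) None None None (keep None) (keep None).

Definition both (T : Type) (a b : T) : {ffun 'I_2 -> T} :=
  [ffun i : 'I_2 => if i == ord0 then a else b].

Definition delta (q : machine_state) (sc : {ffun 'I_2 -> symbol}) :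
    {set machine_state * {ffun 'I_2 -> action}} :=
  [set p : machine_state * {ffun 'I_2 -> action} |
    `[< exists a0 a1, p.2 = both a0 a1 /\
          instr q (sc ord0) (sc ord_max) p.1 a0 a1 >]].

Fact blank_not_input : None \notin [set y : symbol | y != None].
Proof. by rewrite inE. Qed.

Definition machine : turing_machine :=
  @TuringMachine machine_state symbol 1 None [set y | y != None] (idle false)
    [set None] delta blank_not_input.

Notation tape := (tape machine).

Definition conf (q : machine_state) (t0 t1 : tape) : config machine := (q, both t0 t1).

Lemma scanned_conf q (t0 t1 : tape) : scanned (conf q t0 t1) = both t0.1.2 t1.1.2.
Proof. by apply/ffunP=> i; rewrite !ffunE; case: ifP. Qed.

Lemma act_both (t0 t1 : tape) (a0 a1 : action) :
  [ffun i => @tape_act machine (both t0 t1 i) (both a0 a1 i)] =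
  both (tape_act t0 a0) (tape_act t1 a1).
Proof. by apply/ffunP=> i; rewrite !ffunE; case: ifP. Qed.

Lemma step_confP q (t0 t1 : tape) (c' : config machine) :
  reflect (exists q' a0 a1, instr q t0.1.2 t1.1.2 q' a0 a1 /\
             c' = conf q' (tape_act t0 a0) (tape_act t1 a1))
          (step (conf q t0 t1) c').
Proof.
apply: (iffP existsP) => [[[q' a]] | [q' [a0 [a1 [i ->]]]]].
  rewrite scanned_conf inE !ffunE => /andP[/asboolP[a0 [a1 [/= -> i]]] /eqP->].
  by exists q', a0, a1; rewrite act_both.
exists (q', both a0 a1); rewrite inE scanned_conf !ffunE act_both; apply/andP; split=> //.
by apply/asboolP; exists a0, a1.
Qed.

(** Equality up to blanks on the right, in the form that survives [head] and
[behead] with blank as default. *)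
Definition padded (r : seq symbol) u :=
  forall i, nth None r i = nth None (map Some u) i.

Definition holds (t : tape) u := padded t.1.1 [::] /\ padded (t.1.2 :: t.2) u.

Definition hole (t : tape) u :=
  [/\ padded t.1.1 [::], t.1.2 = None & padded t.2 u].

(** The letters that the state still has to write are counted as part of the
stack, so that writing them does not change the contents. *)
Definition pending s (t : tape) u :=
  if s is [::] then holds t u else exists2 u', u = s ++ u' & hole t u'.

Lemma padded_cons (r : seq symbol) u :
  padded (head None r :: behead r) u <-> padded r u.
Proof. by case: r => //=; split=> H i; rewrite -H; case: i => [|[]]. Qed.

Lemma padded_behead (r : seq symbol) : padded r [::] -> padded (behead r) [::].
Proof.
by move=> H i; have:= H i.+1; rewrite nth_behead nth_nil => ->; rewrite nth_nil.
Qed.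

Lemma padded_head (r : seq symbol) : padded r [::] -> head None r = None.
Proof. by move/(_ 0); rewrite nth0. Qed.

Lemma holds_top t u : holds t u -> t.1.2 = ohead u.
Proof. by case=> _ /(_ 0) /= ->; case: u. Qed.

Lemma holds_pop t x u : holds t (x :: u) -> holds (tape_act t pop) u.
Proof.
case: t => [[l a] r] [/= l0 ru]; split=> /=.
  by case=> //= i; rewrite l0 nth_nil.
by apply/padded_cons=> i; apply: (ru i.+1).
Qed.

Lemma hole_grow t u : holds t u -> hole (tape_act t (grow t.1.2)) u.
Proof.
case: t => [[l a] r] [/= l0 ru]; split=> //=; first exact: padded_behead.
exact: padded_head.
Qed.

Lemma act_keep (t : tape) : tape_act t (keep t.1.2) = t.
Proof. by case: t => [[]]. Qed.

Lemma pending_fill s x t u :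
  pending (rcons s x) t u -> pending s (tape_act t (fill x s)) u.
Proof.
have pE r : r <> [::] -> pending r t u -> exists2 u', u = r ++ u' & hole t u'.
  by case: r.
case/pE=> [|u' ->]; first by case: s {pE}.
case: t {pE} => [[l a] r]; case=> /= l0 a0 ru.
case: s => [|y s] /=; first by split=> // -[|i] //=; apply: ru.
exists (x :: u'); first by rewrite cat_rcons.
split=> /=; [exact: padded_behead | exact: padded_head |].
by case=> [|i] //=; apply: ru.
Qed.

Lemma pending_grow s t u :
  s != [::] -> holds t u -> pending s (tape_act t (grow t.1.2)) (s ++ u).
Proof. by case: s => // x s _ /hole_grow; exists u. Qed.

(** The effect of an instruction on the contents of [V] and [L]; none if it only
writes a pending letter. *)
Inductive move : word X -> word X -> word X -> word X -> Prop :=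
| move_none V L : move V L V L
| move_insert s V L : s \in S -> move V L (s ++ V) L
| move_shift x V L : move (x :: V) L V (x :: L)
| move_cancel x V L : move (x :: V) (inv_letter x :: L) V L.

Definition encodes (c : config machine) V L :=
  exists b (s : buffer) t0 t1,
    [/\ c = conf (Some (b, s)) t0 t1,
        pending (if b then [::] else s) t0 V &
        pending (if b then s : word X else [::]) t1 L].

(* Were the empty word inserted, the hole made for it would never be filled. *)
Hypothesis S_neq0 : [::] \notin S.

Lemma pending_idleV b (t : tape) u :
  pending (if b then [::] else (([bseq] : buffer) : word X)) t u -> holds t u.
Proof. by case: b. Qed.

Lemma pending_idleL b (t : tape) u :
  pending (if b then (([bseq] : buffer) : word X) else [::]) t u -> holds t u.
Proof. by case: b. Qed.

Lemma encodes_step c c' V L : encodes c V L -> step c c' ->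
  (exists V' L', move V L V' L' /\ encodes c' V' L') \/
  [/\ c'.1 = None, V = [::] & L = [::]].
Proof.
case=> b [s [t0 [t1 [-> pV pL]]]] /step_confP[q' [a0 [a1 []]]].
move: {-1}(Some _) {-1}(t0.1.2) {-1}(t1.1.2)
  (erefl (Some (b, s))) (erefl t0.1.2) (erefl t1.1.2) => q y0 y1 + + + i.
case: i pV pL => {q y0 y1 q' a0 a1}
  [b' r y0 y1 rS|b' x r y1 eq_r|b' x|x r r' y0 y1 eq_r|x r r' y0 y1 eq_r|b'].
- move=> + + [_ eq_s] <- <-; rewrite {}eq_s.
  move=> /pending_idleV V0 /pending_idleL L0 ->.
  left; exists (r ++ V), L; split; first exact: move_insert.
  exists false, r, (tape_act t0 (grow t0.1.2)), t1; rewrite act_keep; split=> //.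
  by apply: pending_grow => //; apply: contraNneq S_neq0 => <-.
- move=> + + [_ eq_s] E0 <-; rewrite {}eq_s.
  move=> /pending_idleV V0 /pending_idleL L0 ->.
  have := holds_top V0; rewrite E0; case: V V0 => //= z V V0 [zx].
  left; exists V, (x :: L); split; first by rewrite -zx; apply: move_shift.
  exists true, r, (tape_act t0 pop), (tape_act t1 (grow t1.1.2)).
  split=> //; first exact: holds_pop V0.
  by rewrite eq_r; apply: (@pending_grow [:: x]).
- move=> + + [_ eq_s] E0 E1; rewrite {}eq_s.
  move=> /pending_idleV V0 /pending_idleL L0 ->.
  have := holds_top V0; rewrite E0; case: V V0 => //= z V V0 [zx].
  have := holds_top L0; rewrite E1; case: L L0 => //= y L L0 [yx].
  left; exists V, L; split; first by rewrite -zx -yx; apply: move_cancel.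
  exists false, [bseq], (tape_act t0 pop), (tape_act t1 pop).
  by split=> //; [apply: holds_pop V0 | apply: holds_pop L0].
- move=> + + [eq_b eq_s] _ <-; rewrite {}eq_b {}eq_s eq_r => pV pL ->.
  left; exists V, L; split; first exact: move_none.
  exists false, r', (tape_act t0 (fill x r')), t1; rewrite act_keep; split=> //.
  exact: pending_fill.
- move=> + + [eq_b eq_s] <- _; rewrite {}eq_b {}eq_s eq_r => pV pL ->.
  left; exists V, L; split; first exact: move_none.
  exists true, r', t0, (tape_act t1 (fill x r')); rewrite act_keep; split=> //.
  exact: pending_fill.
- move=> + + [_ eq_s] E0 E1; rewrite {}eq_s.
  move=> /pending_idleV V0 /pending_idleL L0 ->.
  right; have := holds_top V0; have := holds_top L0; rewrite E0 E1.
  by case: V V0; case: L L0.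
Qed.

Definition accepts_within n (c : config machine) :=
  exists2 p, path (@step machine) c p & (last c p).1 = None /\ size p <= n.

Lemma accepts_step n c c' :
  step c c' -> accepts_within n c' -> accepts_within n.+1 c.
Proof. by move=> cc' [p c'p [acc le_n]]; exists (c' :: p); rewrite //= cc'. Qed.

Lemma accepts_pending n V L b (s : buffer) (t0 t1 : tape) :
  (forall b t0 t1, holds t0 V -> holds t1 L ->
     accepts_within n (conf (idle b) t0 t1)) ->
  pending (if b then [::] else s) t0 V ->
  pending (if b then s : word X else [::]) t1 L ->
  accepts_within (size s + n) (conf (Some (b, s)) t0 t1).
Proof.
move=> acc; move: {-1}(size s) (erefl (size s)) => k.
elim: k s t0 t1 => [|k IH] s t0 t1 size_s.
  move: size_s => /size0nil s0; have -> : s = [bseq] by apply: val_inj.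
  by move=> /pending_idleV V0 /pending_idleL L0; apply: acc.
have [r [x eq_s]] : exists r x, s = rcons r x :> word X.
  by case/lastP: (s : word X) size_s => // r x _; exists r, x.
move: size_s; rewrite eq_s size_rcons => -[size_r].
have le_r : size r <= buffer_size.
  by apply: leq_trans (size_bseq s); rewrite eq_s size_rcons.
rewrite addSn => pV pL; case: b IH pV pL => IH pV pL.
- pose c' := conf (Some (true, Bseq le_r)) t0 (tape_act t1 (fill x r)).
  apply: (accepts_step (c' := c')).
    apply/step_confP; exists (Some (true, Bseq le_r)), (keep t0.1.2), (fill x r).
    by split; [exact: instr_fillL | rewrite act_keep].
  by apply: IH; rewrite //= -?size_r //; apply: pending_fill.
- pose c' := conf (Some (false, Bseq le_r)) (tape_act t0 (fill x r)) t1.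
  apply: (accepts_step (c' := c')).
    apply/step_confP; exists (Some (false, Bseq le_r)), (fill x r), (keep t1.1.2).
    by split; [exact: instr_fillV | rewrite act_keep].
  by apply: IH; rewrite //= -?size_r //; apply: pending_fill.
Qed.

Lemma leq_buffer_size s : s \in S -> size s <= buffer_size.
Proof. by move=> sS; rewrite leq_max leq_bigmax_seq ?orbT. Qed.

(** The run performs the free reduction of [W] on the stack [L]: at most two steps
for each of its letters, at most [buffer_size + 1] for each insertion, and one
to accept. *)
Lemma accepts_scan k V W L b (t0 t1 : tape) :
  scan S k V W -> red L W = [::] -> holds t0 V -> holds t1 L ->
  accepts_within (k * buffer_size.+1 + 2 * size W + 1) (conf (idle b) t0 t1).
Proof.
move=> h; elim: h L b t0 t1 => {k V W} [k|k x V W _ IH|k s V W sS _ IH] L b t0 t1.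
- move=> /= -> V0 L0; exists [:: conf None t0 t1]; last by rewrite addn1.
  rewrite /= andbT; apply/step_confP; exists None, (keep None), (keep None).
  have [E0 E1] := (holds_top V0, holds_top L0).
  have [K0 K1] := (act_keep t0, act_keep t1); rewrite /= in E0 E1.
  rewrite E0 in K0 *; rewrite E1 in K1 *; rewrite K0 K1.
  by split=> //; apply: instr_accept.
- move=> /= redW V0 L0; rewrite (mulnS 2) (addnCA _ 2) -addnA add2n.
  have V0' := holds_pop V0; have top0 := holds_top V0.
  have [[L' eq_L]|shift] :
      (exists L', L = inv_letter x :: L') \/ red_cons x L = x :: L.
    case: (L) => [|y L'] /=; first by right.
    by case: eqP => [->|_]; [left; exists L' | right].
  + subst L; have top1 := holds_top L0; rewrite /= eqxx in redW.
    pose c' := conf (idle false) (tape_act t0 pop) (tape_act t1 pop).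
    apply: (accepts_step (c' := c')).
      apply/step_confP; exists (idle false), pop, pop; rewrite top0 top1; split=> //.
      exact: instr_cancel.
    have [p cp [acc le_p]] := IH _ false _ _ redW V0' (holds_pop L0).
    by exists p => //; split=> //; apply: leqW.
  + rewrite shift in redW.
    have le1 : size [:: x] <= buffer_size by rewrite leq_maxl.
    pose c' := conf (Some (true, Bseq le1)) (tape_act t0 pop)
      (tape_act t1 (grow t1.1.2)).
    apply: (accepts_step (c' := c')).
      apply/step_confP; exists (Some (true, Bseq le1)), pop, (grow t1.1.2).
      by rewrite top0; split=> //; apply: instr_shift.
    apply: (@accepts_pending _ V (x :: L)) => //=; last exact: (@pending_grow [:: x]).
    by move=> b' t0' t1' V1 L1; apply: IH redW V1 L1.
- move=> redW V0 L0; have le_s := leq_buffer_size sS.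
  rewrite mulSn -!addnA addSn.
  have acc : accepts_within (size s + (k * buffer_size.+1 + 2 * size W + 1))
      (conf (Some (false, Bseq le_s)) (tape_act t0 (grow t0.1.2)) t1).
    apply: (@accepts_pending _ (s ++ V) L) => //=.
      by move=> b' t0' t1'; apply: IH.
    by apply: pending_grow => //; apply: contraNneq S_neq0 => <-.
  have [|p cp [accp le_p]] := @accepts_step _ (conf (idle b) t0 t1) _ _ acc.
    apply/step_confP.
    exists (Some (false, Bseq le_s)), (grow t0.1.2), (keep t1.1.2).
    by rewrite act_keep; split=> //; apply: instr_insert.
  exists p => //; split=> //; apply: leq_trans le_p _.
  by rewrite ltnS -!addnA leq_add2r.
Qed.

Lemma init_conf u : @init_config machine (map Some u) =
  conf (idle false) (@tape_of machine (map Some u)) (@tape_of machine [::]).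
Proof. by congr pair; apply/ffunP=> i; rewrite !ffunE; case: ifP. Qed.

Lemma holds_tape_of u : holds (@tape_of machine (map Some u)) u.
Proof. by split=> //; apply/padded_cons. Qed.

Lemma encodes_init u : encodes (@init_config machine (map Some u)) u [::].
Proof.
exists false, [bseq].
exists (@tape_of machine (map Some u)), (@tape_of machine [::]).
by split; [apply: init_conf | apply: holds_tape_of | apply: (holds_tape_of [::])].
Qed.

Lemma input_wordP (w : seq symbol) :
  @input_word machine w -> exists u, w = map Some u.
Proof.
elim: w => [|[x|] w IH] /=; first by exists [::].
  by case/andP=> _ /IH[u ->]; exists (x :: u).
by rewrite /= inE.
Qed.

Lemma map_Some_input u : @input_word machine (map Some u).
Proof. by rewrite /input_word all_map; apply/allP=> x _ /=; rewrite inE. Qed.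

End Machine.

(** * Time and area *)

Section Time.
Variables (X : finType) (R : seq (word X)).

Notation M := (machine (cyclic_relators R)).

Lemma nil_notin_cyclic_relators : [::] \notin cyclic_relators R.
Proof. by apply/negP=> /cyclic_relatorsP[u [v []]]. Qed.

Lemma area_le_move V L V' L' k : move (cyclic_relators R) V L V' L' ->
  area_le R (rev L' ++ V') k -> area_le R (rev L ++ V) k.+1.
Proof.
case=> {V L V' L'} [V L|s V L sS|x V L|x V L].
- exact: area_leW.
- exact: area_le_delete.
- by rewrite rev_cons cat_rcons; apply: area_leW.
move=> /(area_leW (leqnSn k)); apply: area_le_free_eq.
by rewrite rev_cons cat_rcons; apply: free_eq_Vmul.
Qed.

Lemma area_le_path (c : config M) p V L : encodes c V L ->
  path (@step M) c p -> (last c p).1 = None -> area_le R (rev L ++ V) (size p).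
Proof.
elim: p c V L => [|c' p IH] c V L /=.
  by case=> b [s [t0 [t1 [-> _ _]]]].
move=> cVL /andP[/(encodes_step nil_notin_cyclic_relators cVL)].
case=> [[V' [L' [VL c'VL]]]|[_ -> ->] _ _]; last exact: area_le_nil.
by move=> c'p /(IH _ _ _ c'VL c'p); apply: area_le_move.
Qed.

Lemma accepting_area u p :
  @accepting_computation M (map Some u) p -> area_le R u (size p).
Proof.
by case=> up; rewrite inE => /eqP acc; apply: (area_le_path (encodes_init _ u)) acc.
Qed.

Lemma area_accepting u k : area_le R u k ->
  exists2 p, @accepting_computation M (map Some u) p &
    size p <= (3 * buffer_size (cyclic_relators R) + 1) * k + 2 * size u + 1.
Proof.
case/area_le_scan=> W [uW size_W] redW.
have [p up [acc le_p]] := accepts_scan nil_notin_cyclic_relators false uW redW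
  (holds_tape_of _ u) (holds_tape_of _ [::]).
exists p; first by split; rewrite ?init_conf // inE; apply/eqP.
apply: leq_trans le_p _; rewrite leq_add2r; set B := buffer_size _.
have le_W : size W <= size u + k * B.
  by apply: leq_trans size_W _; rewrite leq_add2l leq_mul2l leq_maxr orbT.
apply: (@leq_trans (k * B.+1 + 2 * (size u + k * B))).
  by rewrite leq_add2l leq_mul2l le_W.
lia.
Qed.

End Time.

Theorem theorem1p1 (X : finType) (R : seq (word X)) (f : nat -> nat) :
  dehn_function R f ->
  exists (M : turing_machine) (T : nat -> nat),
    @time_function M T /\ equivalent f T.
Proof.
case=> isoF minF; pose S := cyclic_relators R.
have [T timeT] := time_function_exists (machine S).
exists (machine S), T; split=> //; split.
  exists 1, 1, 0, 0 => n; rewrite !mul1n !addn0; apply: minF => {}n u le_u u1.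
  have [p acc _] := area_accepting (isoF n u le_u u1).
  have [|||q accq le_q] := (timeT n).1 (map Some u).
  - exact: map_Some_input.
  - by exists p.
  - by rewrite size_map.
  exact: area_leW le_q (accepting_area accq).
exists (3 * buffer_size S + 1), 1, 2, 1 => n; rewrite mul1n.
apply: (timeT n).2 => w /input_wordP[u ->] [p /accepting_area area_u].
rewrite size_map => le_u.
have [q accq le_q] := area_accepting (isoF n u le_u (area_le_group_eq area_u)).
exists q => //; apply: leq_trans le_q _.
by rewrite leq_add2r leq_add2l leq_mul2l le_u.
Qed.
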